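(* Let $q$ be an odd prime power with $q\equiv 3\pmod 4$, let $a,b,c\in F_q^\ast$ with $ab=c^2$, and let $i,j\in F_q^\ast$ and $k\in F_q$. Put $f(i,j,k)=ij-(k-i-j)^2/4\in F_q$. Then $n_{ij}^k$ depends only on $f(i,j,k)$; precisely, \[ n_{ij}^k=\begin{cases}0 & \text{if } f(i,j,k)\text{ is a non-square in } F_q,\\ 1/(q+1) & \text{if } f(i,j,k)=0,\\ 2/(q+1) & \text{if } f(i,j,k)\text{ is a non-zero square in } F_q.\end{cases} \]
   Context: $F_q$ is the finite field with $q$ elements and $F_q^\ast$ its set of non-zero elements. For $i\in F_q$ let $C_i=\{(x,y)\in F_q^2: ax^2+by^2=i\}$. Let $N_{ij}^k$ be the number of pairs $(A,B)\in C_i\times C_j$ with $A+B\in C_k$, and $n_{ij}^k=N_{ij}^k/(|C_i||C_j|)$. *)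

(* Defs.v *)
From mathcomp Require Import all_boot all_order all_algebra.

Set Implicit Arguments.
Unset Strict Implicit.
Unset Printing Implicit Defensive.

Import GRing.Theory.
Local Open Scope ring_scope.

Definition conic (F : finFieldType) (a b i : F) : {set F * F} :=
  [set A | a * A.1 ^+ 2 + b * A.2 ^+ 2 == i].

Definition pair_count (F : finFieldType) (a b i j k : F) : nat :=
  #|[set P : (F * F) * (F * F) |
      [&& P.1 \in conic a b i, P.2 \in conic a b j
        & P.1 + P.2 \in conic a b k]]|.

Definition pair_prob (F : finFieldType) (a b i j k : F) : rat :=
  (pair_count a b i j k)%:R / (#|conic a b i|%:R * #|conic a b j|%:R).

Definition conic_disc (F : finFieldType) (i j k : F) : F :=
  i * j - (k - i - j) ^+ 2 / 4%:R.

(* Zero counts as a square. *)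
Definition is_square (F : finFieldType) (x : F) : bool :=
  [exists y : F, x == y ^+ 2].

(* Main.v *)
Require Import Defs.
From mathcomp Require Import all_boot all_order all_algebra all_fingroup all_solvable.
From mathcomp Require Import all_field ring zify.

Set Implicit Arguments.
Unset Strict Implicit.
Unset Printing Implicit Defensive.

Import GRing.Theory.
Local Open Scope ring_scope.

(** Fix [A] on the conic [C_i] with [i != 0].  The linear map [B |-> (u, v)],
    with [u = a A1 B1 + b A2 B2] and [v = c (A1 B2 - A2 B1)], satisfies
    [u^2 + v^2 = Q(A) Q(B)] (two-square identity, using [ab = c^2]) and
    [Q(A + B) = Q(A) + Q(B) + 2 u].  Hence the [B] in [C_j] with [A + B] in
    [C_k] correspond to [u = (k - i - j) / 2] and to the square roots [v] of
    [f(i, j, k)].  The same map shows that all conics with nonzero right-hand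
    side are equinumerous with the unit circle; since [u^2 + v^2] is anisotropic
    for [q = 3 mod 4], the unit circle has [(q^2 - 1) / (q - 1)] points. *)

Definition twist (F : finFieldType) (a b c : F) (A B : F * F) : F * F :=
  (a * A.1 * B.1 + b * A.2 * B.2, c * (A.1 * B.2 - A.2 * B.1)).

Section Twist.
Variables (F : finFieldType) (a b c : F).
Hypothesis (c_neq0 : c != 0) (ab_sq : a * b = c ^+ 2).

Lemma twist_norm A B :
  (twist a b c A B).1 ^+ 2 + (twist a b c A B).2 ^+ 2 =
  (a * A.1 ^+ 2 + b * A.2 ^+ 2) * (a * B.1 ^+ 2 + b * B.2 ^+ 2).
Proof. by rewrite /twist /= exprMn -ab_sq; ring. Qed.

(** The determinant of [twist a b c A] is [c * i]; the equations [ex] and [ey] below are Cramer's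
    rule. *)
Lemma twist_inj i A : i != 0 -> A \in conic a b i -> injective (twist a b c A).
Proof.
move=> i0; rewrite inE => /eqP Ai [x y] [x' y'] /= [] eu /(mulfI c_neq0) ev.
have /= u0 := congr1 (fun z => z - (a * A.1 * x' + b * A.2 * y')) eu.
have /= v0 := congr1 (fun z => z - (A.1 * y' - A.2 * x')) ev.
rewrite !subrr in u0 v0.
have ex : i * (x - x') = 0.
  transitivity (A.1 * (a * A.1 * x + b * A.2 * y - (a * A.1 * x' + b * A.2 * y'))
    - b * A.2 * (A.1 * y - A.2 * x - (A.1 * y' - A.2 * x'))).
    by rewrite -Ai; ring.
  by rewrite u0 v0 !mulr0 subrr.
have ey : i * (y - y') = 0.
  transitivity (A.2 * (a * A.1 * x + b * A.2 * y - (a * A.1 * x' + b * A.2 * y'))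
    + a * A.1 * (A.1 * y - A.2 * x - (A.1 * y' - A.2 * x'))).
    by rewrite -Ai; ring.
  by rewrite u0 v0 !mulr0 addr0.
by congr (_, _); apply/eqP; rewrite -subr_eq0 -(mulrI_eq0 _ (mulfI i0)) ?ex ?ey.
Qed.

Lemma mem_conic_twist i j A B : i != 0 -> A \in conic a b i ->
  (B \in conic a b j) = (twist a b c A B \in conic 1 1 (i * j)).
Proof.
move=> i0; rewrite !inE !mul1r twist_norm => /eqP ->.
by rewrite (inj_eq (mulfI i0)).
Qed.

(** An injective self-map of the finite plane preserves the size of preimages. *)
Lemma card_conic_twist i j A : i != 0 -> A \in conic a b i ->
  #|conic a b j| = #|conic (1 : F) 1 (i * j)|.
Proof.
move=> i0 Ai; rewrite -[RHS](card_preimset _ (twist_inj i0 Ai)); congr #|pred_of_set _|.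
by apply/setP=> B; rewrite (mem_conic_twist j B i0 Ai) [in RHS]inE.
Qed.

Lemma card_conic_shift i j k A : (2 : F) != 0 -> i != 0 -> A \in conic a b i ->
  #|[set B in conic a b j | A + B \in conic a b k]| =
  #|[set v : F | v ^+ 2 == conic_disc i j k]|.
Proof.
move=> two0 i0 Ai; pose u := (k - i - j) / 2.
have discE : conic_disc i j k = i * j - u ^+ 2.
  by rewrite /conic_disc /u expr_div_n -natrX.
have injp : injective (pair u : F -> F * F) by move=> v w [].
(* The roots [v] become the points [(u, v)], which are pulled back along the bijection
   [twist a b c A]; both sides now count points [B]. *)
rewrite -[RHS](card_imset _ injp) -[RHS](card_preimset _ (twist_inj i0 Ai)).
congr #|pred_of_set _|; apply/setP=> B; rewrite !inE.
have Bj : (a * B.1 ^+ 2 + b * B.2 ^+ 2 == j) =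
    ((twist a b c A B).1 ^+ 2 + (twist a b c A B).2 ^+ 2 == i * j).
  by have := mem_conic_twist j B i0 Ai; rewrite !inE !mul1r.
move: Ai; rewrite inE => /eqP Ai.
have sumE : a * (A + B).1 ^+ 2 + b * (A + B).2 ^+ 2 =
    i + (a * B.1 ^+ 2 + b * B.2 ^+ 2) + (twist a b c A B).1 * 2.
  by rewrite -Ai /=; ring.
have -> : ((a * B.1 ^+ 2 + b * B.2 ^+ 2 == j) &&
    (a * (A + B).1 ^+ 2 + b * (A + B).2 ^+ 2 == k)) =
    ((twist a b c A B).1 == u) && ((twist a b c A B).2 ^+ 2 == conic_disc i j k).
  rewrite sumE discE.
  have uE w : (w == u) = (i + j + w * 2 == k).
    rewrite -(inj_eq (mulIf two0)) divfK // -(inj_eq (addrI (i + j))).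
    by congr (_ == _); ring.
  apply/andP/andP=> [[BB kk] | [uu vv]].
    have uu : (twist a b c A B).1 == u by rewrite uE -(eqP BB).
    split=> //; move: BB; rewrite Bj (eqP uu) => /eqP <-.
    by rewrite addrAC subrr add0r.
  have BB : a * B.1 ^+ 2 + b * B.2 ^+ 2 == j.
    by rewrite Bj (eqP uu) (eqP vv) addrC subrK.
  by rewrite (eqP BB) -uE.
case: (twist _ _ _ _ _) => w v /=; apply/andP/imsetP => [[/eqP -> vv]|].
  by exists v; rewrite ?inE.
by case=> v'; rewrite inE => vv [-> ->].
Qed.

(** The number of admissible [B] is the same for every [A]. *)
Lemma pair_countE i j k : (2 : F) != 0 -> i != 0 ->
  pair_count a b i j k =
  (#|conic a b i| * #|[set v : F | v ^+ 2 == conic_disc i j k]|)%N.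
Proof.
move=> two0 i0; rewrite /pair_count -sum1dep_card.
rewrite -(pair_big_dep (fun A => A \in conic a b i)
  (fun A B => (B \in conic a b j) && (A + B \in conic a b k)) (fun _ _ => 1%N)).
rewrite -sum_nat_const; apply: eq_bigr => A Ai.
by rewrite sum1dep_card (card_conic_shift _ _ two0 i0 Ai).
Qed.

End Twist.

(** Lagrange in the additive group: the order of 1 divides [#|F|]. *)
Lemma natr_card (F : finFieldType) : #|F|%:R = 0 :> F.
Proof.
by apply/eqP; rewrite -FinRing.zmodXgE -order_dvdn -cardsT order_dvdG ?inE.
Qed.

Lemma odd_card_two_neq0 (F : finFieldType) : odd #|F| -> (2 : F) != 0.
Proof.
move=> oddq; apply/eqP => two0; have := natr_card F.
rewrite -(odd_double_half #|F|) oddq natrD -muln2 natrM two0 mulr0 addr0.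
by move/eqP; rewrite oner_eq0.
Qed.

Lemma card_sqrt (F : finFieldType) (x : F) : (2 : F) != 0 ->
  #|[set v : F | v ^+ 2 == x]| =
  if ~~ is_square x then 0%N else if x == 0 then 1%N else 2%N.
Proof.
move=> two0; case: ifPn => [nsq | /negPn /existsP [y /eqP ->]].
  apply/eqP; rewrite cards_eq0; apply/eqP/setP => v; rewrite !inE.
  by apply/negP => /eqP vx; case/existsP: nsq; exists v; rewrite vx.
rewrite expf_eq0 /=; have -> : [set v : F | v ^+ 2 == y ^+ 2] = [set y; - y].
  by apply/setP => v; rewrite !inE eqf_sqr.
(* The roots [y] and [- y] coincide exactly when [y * 2 = 0]. *)
rewrite cards2 -addr_eq0 -mulr2n -mulr_natr mulf_eq0 (negPf two0) orbF.
by case: eqP.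
Qed.

Section Circle.
Variable F : finFieldType.
Hypothesis q_mod4 : #|F| = 3 %[mod 4].

Let m := (#|F| %/ 4)%N.

Let qE : #|F| = (4 * m + 3)%N.
Proof. by have := divn_eq #|F| 4; rewrite q_mod4 mulnC. Qed.

Lemma mod4_two_neq0 : (2 : F) != 0.
Proof. by apply: odd_card_two_neq0; rewrite qE oddD oddM. Qed.

(** With [q = #|F|], the exponent [(2 * m).+1] is [(q - 1) / 2], which is odd; this is Fermat's
    little theorem. *)
Lemma expf_half_mod4 (x : F) : x != 0 -> x ^+ (2 * m).+1 ^+ 2 = 1.
Proof.
move=> x0; apply: (mulIf x0); rewrite mul1r -exprM -exprSr.
by rewrite -[RHS]expf_card qE; congr (_ ^+ _); lia.
Qed.

(** Raising [y ^+ 2 = -1] to the odd power [(q - 1) / 2] would give [1 = -1]. *)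
Lemma oppr1_nsquare (y : F) : y ^+ 2 != -1.
Proof.
apply/eqP => y2; have y0 : y != 0.
  by apply: contra_eqN y2 => /eqP ->; rewrite expr0n eq_sym oppr_eq0 oner_eq0.
have := expf_half_mod4 y0; rewrite exprAC y2 exprS exprM sqrrN !expr1n mulr1.
by move/eqP; rewrite -subr_eq0 -opprD oppr_eq0 (negPf mod4_two_neq0).
Qed.

Lemma square_or_opp (x : F) : is_square x || is_square (- x).
Proof.
have sqP (z : F) : z ^+ (2 * m).+1 = 1 -> is_square z.
  (* Here [z = z ^+ (2 * m + 2)], the square of [z ^+ m.+1]. *)
  move=> z1; apply/existsP; exists (z ^+ m.+1); rewrite -exprM.
  by rewrite mulnC mulnS addnC addn2 exprS z1 mulr1.
have [->|x0] := eqVneq x 0.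
  by apply/orP; left; apply/existsP; exists 0; rewrite expr0n.
have /eqP := expf_half_mod4 x0.
rewrite sqrf_eq1 => /orP [/eqP x1 | /eqP x1]; first by rewrite sqP.
by rewrite (sqP (- x)) ?orbT // exprNn x1 exprS exprM sqrrN !expr1n mulr1 mulrNN mulr1.
Qed.

(* If [-1] were not a sum of two squares, the squares would be closed under
   addition, so that [-1 = q - 1] would be a square. *)
Lemma oppr1_sum_squares : exists x y : F, x ^+ 2 + y ^+ 2 = -1.
Proof.
case: (pickP (fun P : F * F => P.1 ^+ 2 + P.2 ^+ 2 == -1)) => [[x y] /eqP|no].
  by exists x, y.
have sqD1 n : is_square (n%:R : F).
  elim: n => [|n /existsP [x /eqP nx]].
    by apply/existsP; exists 0; rewrite expr0n.
  case/orP: (square_or_opp n.+1%:R) => // /existsP [w /eqP nw].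
  have [->|w0] := eqVneq n.+1%:R (0 : F).
    by apply/existsP; exists 0; rewrite expr0n.
  have {}w0 : w != 0 by apply: contra_neq w0 => w0; rewrite -[LHS]opprK nw w0 expr0n oppr0.
  (* From [n = x ^+ 2] and [n + 1 = - w ^+ 2], division by [w ^+ 2] writes [-1] as the sum of the
     squares of [x / w] and [w^-1]. *)
  have := no (x / w, w^-1); rewrite /= !expr_div_n -nx exprVn -[X in _ + X]mul1r -mulrDl.
  by rewrite -natr1 in nw; rewrite -nw invrN mulrN divff ?eqxx // -oppr_eq0 nw expf_neq0.
have /existsP [y /eqP ym] := sqD1 #|F|.-1.
case/eqP: (oppr1_nsquare y); rewrite -ym; apply/eqP.
by rewrite eq_sym -subr_eq0 -opprD oppr_eq0 addrC natr1 prednK ?natr_card // qE; lia.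
Qed.

(** This provides the base point at which to twist. When [- i = s ^+ 2], a representation of [-1] as
    a sum of two squares is scaled by [s]. *)
Lemma circle_nonempty (i : F) : exists A, A \in conic 1 1 i.
Proof.
case/orP: (square_or_opp i) => /existsP [s /eqP si].
  by exists (s, 0); rewrite inE /= si expr0n mulr0 addr0 mul1r.
have [x [y xy]] := oppr1_sum_squares; exists (x * s, y * s).
by rewrite inE /= !mul1r !exprMn -mulrDl xy mulN1r -si opprK.
Qed.

Lemma card_circle_eq (i : F) : i != 0 -> #|conic 1 1 i| = #|conic (1 : F) 1 1|.
Proof.
move=> i0; have [A Ai] := circle_nonempty i.
have e : 1 * 1 = (1 : F) ^+ 2 by rewrite mul1r expr1n.
by rewrite (card_conic_twist (oner_neq0 _) e 1 i0 Ai) mulr1.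
Qed.

Lemma card_circle0 : #|conic (1 : F) 1 0| = 1%N.
Proof.
rewrite -(cards1 (0 : F * F)); congr #|pred_of_set _|; apply/setP => -[x y].
rewrite !inE /= !mul1r; apply/eqP/eqP => [xy|[-> ->]]; last first.
  by rewrite expr0n addr0.
have [y0|y0] := eqVneq y 0.
  move: xy; rewrite y0 expr0n addr0 => /eqP.
  by rewrite expf_eq0 => /= /eqP ->.
(* Anisotropy: a zero with [y != 0] would make [-1] the square of [x / y]. *)
case/eqP: (oppr1_nsquare (x / y)); rewrite expr_div_n.
have -> : x ^+ 2 = - y ^+ 2 by apply/eqP; rewrite -addr_eq0 xy.
by rewrite mulNr divff // expf_neq0.
Qed.

(** Split the plane by the value of [x ^+ 2 + y ^+ 2]: 0 is taken once and the [q - 1] other values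
    equally often, say [N] times, so [q ^ 2 = 1 + (q - 1) * N]. *)
Lemma card_circle1 : #|conic (1 : F) 1 1| = #|F|.+1.
Proof.
have : (#|F| * #|F| = 1 + #|F|.-1 * #|conic (1%R : F) 1%R 1%R|)%N.
  rewrite -card_prod -[LHS]sum1_card.
  pose norm (P : F * F) := 1 * P.1 ^+ 2 + 1 * P.2 ^+ 2.
  have fibre i : (\sum_(P | norm P == i) 1 = #|conic 1%R 1%R i|)%N.
    exact: sum1dep_card.
  rewrite (partition_big norm predT) //= (bigD1 0) //= fibre card_circle0.
  congr addn; rewrite -(cardC1 (0 : F)) -sum_nat_const.
  by apply: eq_bigr => i i0; rewrite fibre card_circle_eq.
by rewrite qE; nia.
Qed.

Lemma card_conic (a b c j : F) : a != 0 -> c != 0 -> a * b = c ^+ 2 -> j != 0 ->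
  #|conic a b j| = #|F|.+1.
Proof.
(* The point [(1, 0)] serves as base point; it lies on the conic with right-hand side [a]. *)
move=> a0 c0 ab j0; have A1 : (1, 0) \in conic a b a.
  by rewrite inE /= expr1n expr0n mulr0 addr0 mulr1.
by rewrite (card_conic_twist c0 ab j a0 A1) card_circle_eq ?card_circle1 ?mulf_neq0.
Qed.

End Circle.

Theorem theorem1 (F : finFieldType) (q : nat) (card_F : #|F| = q)
    (q_odd : odd q) (q_mod4 : q = 3 %[mod 4])
    (a b c : F) (a_neq0 : a != 0) (b_neq0 : b != 0) (c_neq0 : c != 0)
    (ab_sq : a * b = c ^+ 2)
    (i j k : F) (i_neq0 : i != 0) (j_neq0 : j != 0) :
  pair_prob a b i j k =
    if ~~ is_square (conic_disc i j k) then 0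
    else if conic_disc i j k == 0 then 1 / (q%:R + 1)
    else 2%:R / (q%:R + 1).
Proof.
subst q; have two0 := odd_card_two_neq0 q_odd.
rewrite /pair_prob (pair_countE c_neq0 ab_sq _ _ two0 i_neq0).
rewrite !(card_conic q_mod4 a_neq0 c_neq0 ab_sq) // natrM natr1.
have q0 : #|F|.+1%:R != 0 :> rat by rewrite Num.Theory.pnatr_eq0.
(* One factor [q + 1] cancels, leaving the number of square roots of the discriminant over
   [q + 1]. *)
rewrite -mulf_div divff // mul1r card_sqrt //.
by case: ifP => _; [rewrite mul0r | case: ifP].
Qed.
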